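(* Let $m$ and $n$ be two non-negative integers such that $n\leq 20m$. Then $X^{(m)}(n)$ is nonnegative.
   Context: For a non-negative integer $m$, the integers $X^{(m)}(n)$ ($n\ge 0$) are defined as the coefficients of the $q$-series (formal power series in $q$, or $|q|<1$) $$\sum_{n\geq0}X^{(m)}(n)q^{n}:=\frac{1}{1-q^{2}}\left(\sum_{n=1}^{\infty}\frac{(-1)^{n}q^{n(3n+1)+2mn}}{1-q^{2n}}-\sum_{n=1}^{\infty}\frac{(-1)^{n}q^{\frac{n(n+1)}{2}+mn}}{1-q^{n}}\right).$$ *)

(* Defs.v *)
From mathcomp Require Import all_boot all_order all_algebra.

Set Implicit Arguments.
Unset Strict Implicit.
Unset Printing Implicit Defensive.

Import Order.TTheory GRing.Theory Num.Theory.
Local Open Scope ring_scope.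

(* A formal power series in q with integer coefficients is represented by its
   coefficient sequence: [f k] is the coefficient of q^k. *)
Definition fps := nat -> int.

Definition fps_monom (c : int) (e : nat) : fps :=
  fun k => if k == e then c else 0.

Definition fps_sub (f g : fps) : fps := fun k => f k - g k.

Definition fps_mul (f g : fps) : fps :=
  fun k => \sum_(i < k.+1) f i * g (k - i)%N.

(* 1 / (1 - q^d) for d > 0, as the geometric series q^0 + q^d + q^(2d) + ...;
   see [fps_geomE]. *)
Definition fps_geom (d : nat) : fps := fun k => (d %| k)%N%:R.

(* The infinite sum a 1 + a 2 + a 3 + ... of a family in which a n has order
   at least n: the coefficient of q^k only involves a 1, ..., a k;
   see [fps_sum1_stable]. *)
Definition fps_sum1 (a : nat -> fps) : fps :=
  fun k => \sum_(1 <= n < k.+1) a n k.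

Definition X_term1 (m n : nat) : fps :=
  fps_mul (fps_monom ((-1) ^+ n) (n * (3 * n + 1) + 2 * m * n)%N)
          (fps_geom (2 * n)).

Definition X_term2 (m n : nat) : fps :=
  fps_mul (fps_monom ((-1) ^+ n) (n * (n + 1) %/ 2 + m * n)%N)
          (fps_geom n).

Definition X (m : nat) : fps :=
  fps_mul (fps_geom 2)
          (fps_sub (fps_sum1 (X_term1 m)) (fps_sum1 (X_term2 m))).

Lemma fps_monom_mulE (c : int) (e : nat) (g : fps) (k : nat) :
  fps_mul (fps_monom c e) g k = if (e <= k)%N then c * g (k - e)%N else 0.
Proof.
rewrite /fps_mul /fps_monom; case: leqP => [le_ek | lt_ke].
  rewrite (bigD1 (Ordinal (le_ek : (e < k.+1)%N))) //= eqxx.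
  rewrite big1 ?addr0 // => i ne_i.
  by rewrite ifN ?mul0r.
rewrite big1 // => i _; rewrite ifN ?mul0r //.
by rewrite neq_ltn (leq_ltn_trans _ lt_ke) // -ltnS.
Qed.

Lemma fps_geomE (d : nat) : (0 < d)%N ->
  fps_mul (fps_sub (fps_monom 1 0) (fps_monom 1 d)) (fps_geom d)
    =1 fps_monom 1 0.
Proof.
move=> d_gt0 k.
have -> : fps_mul (fps_sub (fps_monom 1 0) (fps_monom 1 d)) (fps_geom d) k =
    fps_mul (fps_monom 1 0) (fps_geom d) k
    - fps_mul (fps_monom 1 d) (fps_geom d) k.
  by rewrite /fps_mul -sumrB; apply: eq_bigr => i _; rewrite mulrBl.
rewrite !fps_monom_mulE leq0n subn0 /fps_geom /fps_monom !mul1r.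
case: leqP => [le_dk | lt_kd].
  by rewrite dvdn_subl // subrr ifN // -lt0n (leq_trans d_gt0).
case: posnP => [-> | k_gt0]; first by rewrite dvdn0 subr0.
by rewrite gtnNdvd // subr0.
Qed.

Lemma fps_sum1_stable (a : nat -> fps) (k N : nat) :
  (forall n j, (j < n)%N -> a n j = 0) -> (k <= N)%N ->
  \sum_(1 <= n < N.+1) a n k = fps_sum1 a k.
Proof.
move=> a0 le_kN; rewrite /fps_sum1 (@big_cat_nat _ _ _ k.+1) //= addrC.
rewrite big_nat_cond big1 ?add0r // => n /andP[/andP[lt_kn _] _].
exact: a0.
Qed.

Lemma X_term1_order (m n j : nat) : (j < n)%N -> X_term1 m n j = 0.
Proof.
move=> lt_jn; rewrite /X_term1 fps_monom_mulE ifN // -ltnNge.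
apply: (leq_trans lt_jn); rewrite (leq_trans _ (leq_addr _ _)) //.
by rewrite leq_pmulr // addn1.
Qed.

Lemma X_term2_order (m n j : nat) : (j < n)%N -> X_term2 m n j = 0.
Proof.
move=> lt_jn; rewrite /X_term2 fps_monom_mulE ifN // -ltnNge.
apply: (leq_trans lt_jn); rewrite (leq_trans _ (leq_addr _ _)) //.
rewrite leq_divRL // leq_mul2l addn1 ltnS.
by rewrite (leq_ltn_trans (leq0n j) lt_jn) orbT.
Qed.

(* Main.v *)
Require Import Defs.
From mathcomp Require Import all_boot all_order all_algebra.
From mathcomp Require Import zify ring.
Import Order.TTheory GRing.Theory Num.Theory.
Local Open Scope ring_scope.

(** Write the bracket that defines X^(m) as A - B, so that X = (A - B) / (1-q^2).
    The infinite series A and B nearly cancel, once the N-th term of A is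
    grouped with the 2N-th term of B, which has the same denominator 1 - q^(2N),
    and, for N odd, with the N-th term of B as well; every term of B is used
    exactly once. Call the result the N-th block.

    - If N = 2a is even, the numerators are two powers of q whose exponents
      differ by a multiple of the 4a in the denominator 1 - q^(4a), so the block
      is a polynomial: minus the sum of the a monomials
      q^(8a^2 + 2a + 4ma + 4ai), 0 <= i < a  ([X_block_even]).
    - If N is odd, the positive series q^(N(N+1)/2 + mN) / (1 - q^N) dominates
      the two others coefficientwise ([X_block_odd_ge0]).
    - If N = 1, the block is exactly q^(m+1) + ... + q^(2m+2)  ([X_block1]).

    Dividing by 1 - q^2 and reading off the coefficient of q^n, a monomial q^e
    contributes 1 if e <= n and e = n modulo 2, and 0 otherwise. The block of
    N = 2a thus contributes at least -a ([geom_block_even_ge]), and nothing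
    when n < 8a^2 + 2a + 4ma ([geom_block_even0]). For n <= 20m the latter holds
    whenever a >= 5, so at most 1 + 2 + 3 + 4 negative units ever appear, and
    the a-th group of them can only appear when m is large enough. On the other
    side, as soon as n >= 2m + 2, the block of N = 1 contributes one unit for
    every exponent of the right parity among m + 2 consecutive ones, hence at
    least floor((m+2)/2) ([geom_block1_ge]), which pays for the negative units
    for every m. *)

(** The series q^e / (1 - q^d). *)
Definition qgeom (d e : nat) : fps := fun j => ((e <= j) && (d %| j - e))%N%:R.

Lemma qgeom_ge0 d e j : 0 <= qgeom d e j.
Proof. by rewrite /qgeom ler0n. Qed.

Lemma qgeom_le1 d e j : qgeom d e j <= 1.
Proof. by rewrite /qgeom lern1; case: (_ && _). Qed.

Lemma qgeom_order d e j : (j < e)%N -> qgeom d e j = 0.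
Proof. by rewrite /qgeom ltnNge => /negbTE ->. Qed.

Lemma qgeom_step d e j : (0 < d)%N -> qgeom d e j = (j == e)%:R + qgeom d (e + d) j.
Proof.
move=> d_gt0; rewrite /qgeom; case: (ltngtP j e) => [lt_je | lt_ej | ->].
- by rewrite leqNgt ltn_addr.
- rewrite add0r; case: (leqP (e + d) j) => [le_j | lt_j] /=.
    by rewrite subnDA [in RHS]dvdn_subl //; lia.
  by rewrite gtnNdvd //; lia.
- by rewrite subnn dvdn0 leqNgt -[ltnLHS]addn0 ltn_add2l d_gt0 addr0.
Qed.

(** The identity behind all cancellations: two series with the same denominator
    1 - q^d and exponents that agree modulo d differ by a polynomial. *)
Lemma qgeom_unroll d e t j : (0 < d)%N ->
  qgeom d e j = \sum_(0 <= i < t) (j == e + d * i)%N%:R + qgeom d (e + d * t) j.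
Proof.
move=> d_gt0; elim: t => [|t IHt]; first by rewrite big_nil muln0 addn0 add0r.
by rewrite big_nat_recr //= -addrA mulnSr addnA -qgeom_step.
Qed.

Lemma qgeom_shift_le d e t j : (0 < d)%N -> qgeom d (e + d * t) j <= qgeom d e j.
Proof.
move=> d_gt0; rewrite (qgeom_unroll d e t) // lerDr.
by apply: sumr_ge0 => i _; rewrite ler0n.
Qed.

(** This is 1 / (1 - q^d) = (1 + q^d) / (1 - q^(2d)); it lets the odd blocks mix
    the denominators 1 - q^N and 1 - q^(2N). *)
Lemma qgeom_double d e j : (0 < d)%N ->
  qgeom d e j = qgeom (2 * d) e j + qgeom (2 * d) (e + d) j.
Proof.
move=> d_gt0; rewrite /qgeom.
case: (leqP e j) => [le_ej | lt_je]; last by rewrite leqNgt ltn_addr.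
rewrite subnDA -leq_subRL //=; move: (j - e)%N => x.
case: (boolP (d %| x)%N) => [/dvdnP[c ->] | ndvd].
  have -> : (c * d - d = c.-1 * d)%N by rewrite -subn1 mulnBl mul1n.
  have -> : (d <= c * d)%N = (0 < c)%N by rewrite -{1}[d]mul1n leq_pmul2r.
  by rewrite !dvdn_pmul2r //; case: c => [|c] //=; rewrite !dvdn2 /=; case: odd.
have ndvd2 y : (d %| y)%N = false -> (2 * d %| y)%N = false.
  by move=> dy; apply: contraFF dy; apply: dvdn_trans; apply: dvdn_mull.
rewrite ndvd2 ?(negbTE ndvd) //.
case: leqP => //= le_dx; rewrite ndvd2 // dvdn_subl //; exact: negbTE.
Qed.

Lemma X_term1E m N j :
  X_term1 m N j = (-1) ^+ N * qgeom (2 * N) (N * (3 * N + 1) + 2 * m * N) j.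
Proof.
by rewrite /X_term1 fps_monom_mulE /qgeom; case: leqP => // _; rewrite mulr0.
Qed.

Lemma X_term2E m N j :
  X_term2 m N j = (-1) ^+ N * qgeom N (N * (N + 1) %/ 2 + m * N) j.
Proof.
by rewrite /X_term2 fps_monom_mulE /qgeom; case: leqP => // _; rewrite mulr0.
Qed.

(** Subtracting the terms 2N of B for all N and N for N odd exhausts B, since
    every positive integer is either even or odd; this is what makes the blocks
    add up to A - B (see [X_blocksE]). *)
Definition X_block (m N : nat) : fps := fun j =>
  X_term1 m N j - X_term2 m (2 * N) j - (if odd N then X_term2 m N j else 0).

Lemma sum_odd_even (V : nmodType) (F : nat -> V) K :
  \sum_(1 <= n < (2 * K).+1) F n =
    \sum_(1 <= n < (2 * K).+1) (if odd n then F n else 0)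
    + \sum_(1 <= N < K.+1) F (2 * N)%N.
Proof.
elim: K => [|K IHK]; first by rewrite !big_geq // addr0.
have def2K : (2 * K.+1 = (2 * K).+2)%N by rewrite mulnS.
rewrite def2K !(big_nat_recr (2 * K).+2) // !(big_nat_recr (2 * K).+1) //.
rewrite (big_nat_recr K.+1) //= def2K oddM /= addr0 IHK.
by rewrite -!addrA; congr (_ + _); rewrite addrCA addrA.
Qed.

(** Below order K, the terms N <= K of A suffice, and so do the terms of B up to
    any bound >= K: the bound 2K makes the even indices 2N run over N <= K, and
    the odd indices beyond K can then be dropped again. *)
Lemma X_blocksE m j K : (j <= K)%N ->
  fps_sub (fps_sum1 (X_term1 m)) (fps_sum1 (X_term2 m)) j
  = \sum_(1 <= N < K.+1) X_block m N j.
Proof.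
move=> le_jK; rewrite /fps_sub.
rewrite -(fps_sum1_stable (@X_term1_order m) le_jK).
have le_j2K : (j <= 2 * K)%N by lia.
rewrite -(fps_sum1_stable (@X_term2_order m) le_j2K) sum_odd_even.
pose odd_term n : fps := fun i => if odd n then X_term2 m n i else 0.
have odd0 n i : (i < n)%N -> odd_term n i = 0.
  by rewrite /odd_term; case: ifP => // _ /X_term2_order.
rewrite (fps_sum1_stable odd0 le_j2K) -(fps_sum1_stable odd0 le_jK).
by rewrite opprD addrCA addrC -!sumrB.
Qed.

(** With N = 2a both signs (-1)^N and (-1)^(2N) are +, and the exponents
    12a^2 + 2a + 4ma in A and 8a^2 + 2a + 4ma in B differ by a * 4a, i.e. by a
    steps of the common denominator 1 - q^(4a). *)
Lemma X_block_even m a j : (0 < a)%N ->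
  X_block m (2 * a) j =
    - \sum_(0 <= i < a)
        (j == 8 * a ^ 2 + 2 * a + 4 * m * a + 4 * a * i)%N%:R.
Proof.
move=> a_gt0; rewrite /X_block X_term1E X_term2E oddM /= subr0.
rewrite !mulnA !exprM sqrrN !expr1n !mul1r.
have -> : (2 * 2 * a * (2 * 2 * a + 1) %/ 2 + m * 2 * 2 * a
           = 8 * a ^ 2 + 2 * a + 4 * m * a)%N.
  have -> : (2 * 2 * a * (2 * 2 * a + 1) = (8 * a ^ 2 + 2 * a) * 2)%N by ring.
  by rewrite mulnK //; ring.
rewrite (@qgeom_unroll _ (8 * a ^ 2 + 2 * a + 4 * m * a) a) ?muln_gt0 //.
have -> : (2 * a * (3 * 2 * a + 1) + 2 * m * 2 * a
           = 8 * a ^ 2 + 2 * a + 4 * m * a + 2 * 2 * a * a)%N by ring.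
rewrite opprD addrCA subrr addr0; congr (- _).
by apply: eq_bigr => i _; rewrite !mulnA.
Qed.

(** For N odd the term of A is negative, with exponent
    e1 = 3N^2 + N + 2mN, and so is the term 2N of B, with exponent
    e2 = 2N^2 + N + 2mN; both have denominator 1 - q^(2N). As e1 exceeds e2 + N
    by N^2 - N, a multiple of 2N, the first series is at most
    q^(e2+N) / (1 - q^(2N)), so together they are at most q^e2 / (1 - q^N),
    and this is below the positive series q^e3 / (1 - q^N) because e2 - e3 is a
    nonnegative multiple of N. *)
Lemma X_block_odd_ge0 m N j : odd N -> 0 <= X_block m N j.
Proof.
move=> oddN; have N_gt0 : (0 < N)%N by case: N oddN.
rewrite /X_block X_term1E !X_term2E oddN exprM sqrrN expr1n.
rewrite -signr_odd oddN expr1 !mulN1r mul1r opprK.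
have -> : (2 * N * (2 * N + 1) %/ 2 = N * (2 * N + 1))%N.
  by rewrite -mulnA mulKn.
pose b := N./2; have defN : N = (2 * b + 1)%N.
  by rewrite -(odd_double_half N) oddN -mul2n addnC.
have defT : (N * (N + 1) %/ 2 = N * (b + 1))%N.
  by rewrite {2}defN -addnA -[(1 + 1)%N]/(2 * 1)%N -mulnDr mulnCA mulKn.
set e1 := (N * (3 * N + 1) + _)%N; set e2 := (N * (2 * N + 1) + _)%N.
have defe1 : e1 = (e2 + N + 2 * N * b)%N by rewrite /e1 /e2 defN; ring.
have le1 : qgeom (2 * N) e1 j <= qgeom (2 * N) (e2 + N) j.
  by rewrite defe1 qgeom_shift_le // muln_gt0.
have := @qgeom_double N e2 j N_gt0.
set e3 := (_ %/ 2 + _)%N.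
have defe2 : e2 = (e3 + N * (m + 3 * b + 2))%N.
  by rewrite /e2 /e3 defT defN; ring.
have := @qgeom_shift_le N e3 (m + 3 * b + 2)%N j N_gt0; rewrite -defe2.
move: le1; lia.
Qed.

(** The case N = 1 of the domination above, where the comparison of the two
    negative series is an equality, so that the block is a polynomial. *)
Lemma X_block1 m j :
  X_block m 1 j = \sum_(0 <= i < m.+2) (j == m.+1 + i)%N%:R.
Proof.
rewrite /X_block X_term1E !X_term2E /= expr1 sqrrN expr1n !mulN1r mul1r.
have := @qgeom_double 1 (2 * m + 3) j isT.
have := @qgeom_unroll 1 m.+1 m.+2 j isT.
rewrite (eq_bigr (fun i => (j == m.+1 + i)%N%:R)); last first.
  by move=> i _; rewrite mul1n.
rewrite !mul1n !muln1 -[(1 * 2 %/ 2)%N]/1%N -[(2 * 3 %/ 2)%N]/3%N.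
rewrite (_ : m.+1 + m.+2 = 2 * m + 3)%N; last by lia.
rewrite (_ : 3 + 1 + 2 * m = 2 * m + 3 + 1)%N; last by lia.
rewrite (_ : 3 + m * 2 = 2 * m + 3)%N; last by lia.
rewrite (_ : 1 + m = m.+1)%N; last by lia.
by move=> -> ->; ring.
Qed.

Lemma fps_mulC (f g : fps) k : fps_mul f g k = fps_mul g f k.
Proof.
rewrite /fps_mul (reindex_inj rev_ord_inj) /=.
by apply: eq_bigr => i _; rewrite subSS mulrC subKn // -ltnS.
Qed.

(** Turns a block known as a polynomial into the corresponding coefficient of
    its quotient by 1 - q^d; the scalar c is there for the sign -1 of the even
    blocks. *)
Lemma geom_mul_monoms d t (e : nat -> nat) (c : int) (F : fps) k :
  (forall j, F j = c * \sum_(0 <= i < t) (j == e i)%:R) ->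
  fps_mul (fps_geom d) F k = c * \sum_(0 <= i < t) qgeom d (e i) k.
Proof.
move=> defF; rewrite fps_mulC /fps_mul.
under eq_bigr do rewrite defF -mulrA mulr_suml.
rewrite -mulr_sumr exchange_big /=; congr (_ * _); apply: eq_bigr => i _.
transitivity (fps_mul (fps_monom 1 (e i)) (fps_geom d) k).
  by apply: eq_bigr => l _; rewrite /fps_monom; case: eqP.
by rewrite fps_monom_mulE mul1r /qgeom; case: leqP.
Qed.

Lemma X_sumE m k K : (k <= K)%N ->
  X m k = \sum_(1 <= N < K.+1) fps_mul (fps_geom 2) (X_block m N) k.
Proof.
move=> le_kK; rewrite /X /fps_mul exchange_big /=; apply: eq_bigr => i _.
by rewrite -mulr_sumr -X_blocksE // (leq_trans (leq_subr _ _)).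
Qed.

Lemma geom_block_odd_ge0 m N k :
  odd N -> 0 <= fps_mul (fps_geom 2) (X_block m N) k.
Proof.
move=> oddN; apply: sumr_ge0 => i _; apply: mulr_ge0; first exact: ler0n.
exact: X_block_odd_ge0.
Qed.

Lemma geom_block_even m a k : (0 < a)%N ->
  fps_mul (fps_geom 2) (X_block m (2 * a)) k =
    - \sum_(0 <= i < a) qgeom 2 (8 * a ^ 2 + 2 * a + 4 * m * a + 4 * a * i) k.
Proof.
move=> a_gt0; rewrite -mulN1r.
by apply: geom_mul_monoms => j; rewrite mulN1r X_block_even.
Qed.

Lemma geom_block_even0 m a k :
  (0 < a)%N -> (k < 8 * a ^ 2 + 2 * a + 4 * m * a)%N ->
  fps_mul (fps_geom 2) (X_block m (2 * a)) k = 0.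
Proof.
move=> a_gt0 lt_k; rewrite geom_block_even // big1 ?oppr0 // => i _.
by rewrite qgeom_order // ltn_addr.
Qed.

Lemma geom_block_even_ge m a k : (0 < a)%N ->
  - a%:R <= fps_mul (fps_geom 2) (X_block m (2 * a)) k.
Proof.
move=> a_gt0; rewrite geom_block_even // lerN2.
apply: (@le_trans _ _ (\sum_(0 <= i < a) 1)).
  by apply: ler_sum => i _; apply: qgeom_le1.
by rewrite sumr_const_nat subn0.
Qed.

(** Among two consecutive exponents not exceeding k, exactly one has the parity
    of k, so no case distinction on that parity is needed. *)
Lemma sum_qgeom2 e s k : (e + 2 * s <= k.+1)%N ->
  \sum_(0 <= i < 2 * s) qgeom 2 (e + i) k = s%:R.
Proof.
elim: s => [|s IHs] le_k; first by rewrite big_nil.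
have -> : (2 * s.+1 = (2 * s).+2)%N by rewrite mulnS.
rewrite !big_nat_recr //= IHs; last by lia.
have qgeom1 : qgeom 1 (e + 2 * s) k = 1.
  by rewrite /qgeom dvd1n (_ : e + 2 * s <= k)%N //; lia.
by rewrite -addrA addnS -[(_ + _).+1]addn1 -[2%N]/(2 * 1)%N -qgeom_double // qgeom1 natr1.
Qed.

Lemma geom_block1_ge m k : (2 * m + 2 <= k)%N ->
  (m.+2 %/ 2)%:R <= fps_mul (fps_geom 2) (X_block m 1) k.
Proof.
move=> le_k; rewrite (@geom_mul_monoms 2 m.+2 (fun i => m.+1 + i)%N 1).
  rewrite mul1r (@big_cat_nat _ _ _ (2 * (m.+2 %/ 2))%N) //=; last by lia.
  rewrite sum_qgeom2 ?lerDl; last by lia.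
  by apply: sumr_ge0 => i _; apply: qgeom_ge0.
by move=> j; rewrite mul1r X_block1.
Qed.

Theorem theorem1p2 (m n : nat) (hn : (n <= 20 * m)%N) : 0 <= X m n.
Proof.
(* The slack 8 guarantees that the blocks N = 1, ..., 8, which are treated
   individually, all occur in the sum. *)
rewrite (@X_sumE m n (n + 8)) ?leq_addr //.
rewrite (@big_cat_nat _ _ _ 9) //=; last by lia.
apply: addr_ge0; last first.
  rewrite big_nat; apply: sumr_ge0 => N /andP[N_ge9 _].
  case: (boolP (odd N)) => [/geom_block_odd_ge0 // | evenN].
  have defN : N = (2 * N./2)%N.
    by rewrite -{1}(odd_double_half N) (negbTE evenN) add0n -mul2n.
  (* N = 2a with a >= 5, so the block starts beyond 4ma >= 20m >= n. *)
  by rewrite defN geom_block_even0 //; nia.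
rewrite 8?big_nat_recl //= big_geq // addr0.
have B3 := geom_block_odd_ge0 m 3 n isT.
have B5 := geom_block_odd_ge0 m 5 n isT.
have B7 := geom_block_odd_ge0 m 7 n isT.
(* The exponent 4m + 10 is the smallest one that carries a minus sign. *)
case: (ltnP n (4 * m + 10)) => [lt_n | ge_n].
  have B1 := geom_block_odd_ge0 m 1 n isT.
  rewrite (geom_block_even0 m 1) ?(geom_block_even0 m 2) //; try lia.
  rewrite (geom_block_even0 m 3) ?(geom_block_even0 m 4) //; try lia.
have B1 := @geom_block1_ge m n ltac:(lia).
have B2 := geom_block_even_ge m 1 n isT.
have B6 := geom_block_even_ge m 3 n isT.
have B8 := geom_block_even_ge m 4 n isT.
have B6' := geom_block_even0 m 3 n isT.
have B8' := geom_block_even0 m 4 n isT.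
(* The two monomials of the block N = 4 are kept apart: for m = 3 the positive
   part is only bounded below by 2, and it is the absence of the second
   monomial that saves the inequality. *)
have B4 := geom_block_even m 2 n isT.
rewrite 2?big_nat_recl // big_geq // addr0 in B4.
have A1 := qgeom_le1 2 (8 * 2 ^ 2 + 2 * 2 + 4 * m * 2 + 4 * 2 * 0) n.
have A2 := qgeom_le1 2 (8 * 2 ^ 2 + 2 * 2 + 4 * m * 2 + 4 * 2 * 1) n.
have A1' := @qgeom_order 2 (8 * 2 ^ 2 + 2 * 2 + 4 * m * 2 + 4 * 2 * 0) n.
have A2' := @qgeom_order 2 (8 * 2 ^ 2 + 2 * 2 + 4 * m * 2 + 4 * 2 * 1) n.
(* The bound n <= 20m lets the second monomial of block 4 occur only for
   m >= 4, block 6 for m >= 10 and block 8 for m >= 34. *)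
move: B1 B2 B3 B4 B5 B6 B7 B8 B6' B8' A1 A2 A1' A2'.
rewrite -[(2 * 1)%N]/2%N -[(2 * 2)%N]/4%N -[(2 * 3)%N]/6%N -[(2 * 4)%N]/8%N.
do !move: (fps_mul _ (X_block m _) n) => ?.
move: (qgeom 2 _ n) (qgeom 2 _ n) => ? ?.
lia.
Qed.
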